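(* The $\sigma$-nilpotency, $\sigma$-solubility, $\sigma$-subnormality and $\sigma$-$p$-permutability are $\sigma$-properties. That is, for every finite group $G$, every subgroup $H\leq G$ and all partitions $\sigma,\sigma^1,\sigma^2$ of $\pi(G)$: \begin{enumerate} \item if $G$ is $\sigma^1$-nilpotent and $\sigma^2$-nilpotent, then $G$ is $(\sigma^1\cap\sigma^2)$-nilpotent; and if $|\sigma|=1$, then $G$ is $\sigma$-nilpotent; \item if $G$ is $\sigma^1$-soluble and $\sigma^2$-soluble, then $G$ is $(\sigma^1\cap\sigma^2)$-soluble; and if $|\sigma|=1$, then $G$ is $\sigma$-soluble; \item if $H$ is $\sigma^1$-subnormal and $\sigma^2$-subnormal in $G$, then $H$ is $(\sigma^1\cap\sigma^2)$-subnormal in $G$; and if $|\sigma|=1$, then $H$ is $\sigma$-subnormal in $G$; \item if $H$ is $\sigma^1$-$p$-permutable and $\sigma^2$-$p$-permutable in $G$, then $H$ is $(\sigma^1\cap\sigma^2)$-$p$-permutable in $G$; and if $|\sigma|=1$, then $H$ is $\sigma$-$p$-permutable in $G$. \end{enumerate}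
   Context: All groups are finite. $\pi(G)$ is the set of prime divisors of $|G|$. For a set of primes $\pi$, a $\pi$-group is a group all of whose order's prime divisors lie in $\pi$; a Hall $\pi$-subgroup of $G$ is a $\pi$-subgroup whose index in $G$ is divisible by no prime in $\pi$. For partitions $\sigma^1,\sigma^2$ of the same set, $\sigma^1\cap\sigma^2=\{\sigma^1_i\cap\sigma^2_j\mid \sigma^1_i\in\sigma^1,\sigma^2_j\in\sigma^2\}$ (empty intersections discarded), which is again a partition of that set. A $\sigma$-property is a property $\theta=\theta(\sigma)$ of a subgroup $H$ in a group $G$ (depending on a partition $\sigma$ of $\pi(G)$) such that (1) if $H$ has properties $\theta(\sigma^1)$ and $\theta(\sigma^2)$ in $G$, then it has property $\theta(\sigma^1\cap\sigma^2)$ in $G$; (2) if $|\sigma|=1$, then $H$ has property $\theta(\sigma)$ in $G$. For $\sigma$-nilpotency and $\sigma$-solubility, which are properties of a group, the property is considered for the group $G$ itself. Let $\sigma$ be a partition of a set of primes containing $\pi(G)$ (a partition is applied to a subgroup or section of $G$ without change; blocks disjoint from its set of prime divisors are irrelevant). - $G$ is $\sigma$-nilpotent if it has a normal Hall $\sigma_i$-subgroup for every $\sigma_i\in\sigma$. - $G$ is $\sigma$-soluble if every chief factor of $G$ is a $\sigma_i$-group for some $\sigma_i\in\sigma$. - A subgroup $H$ of $G$ is $\sigma$-subnormal in $G$ if there is a chain of subgroups $H=H_0\leq\dots\leq H_n=G$ such that for each $1\leq i\leq n$ either $H_{i-1}\trianglelefteq H_i$ or $H_i/(H_{i-1})_{H_i}$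 is a $\sigma_j$-group for some $\sigma_j\in\sigma$. Here $X_Y$ is the greatest normal subgroup of $Y$ contained in $X$. - For a set of primes $\pi$, a $\mathfrak{G}_\pi$-projector of $G$ is a subgroup $P\leq G$ such that $PN/N$ is maximal (under inclusion) among $\pi$-subgroups of $G/N$ for every $N\trianglelefteq G$. A subgroup $H$ of $G$ is $\sigma$-$p$-permutable in $G$ if for every $\sigma_i\in\sigma$ there is a $\mathfrak{G}_{\sigma_i}$-projector $H_i$ of $G$ such that $HH_i^x=H_i^xH$ for every $x\in G$ (the letter $p$ is part of the name, not a prime). *)

(* Defs.v *)
From mathcomp Require Import all_boot all_fingroup all_solvable.
From mathcomp Require Import finmap.

Set Implicit Arguments.
Unset Strict Implicit.
Unset Printing Implicit Defensive.

Local Open Scope fset_scope.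
Local Open Scope group_scope.

Definition prime_divisors (n : nat) : {fset nat} := [fset p in primes n].

Definition fset_partition (sigma : {fset {fset nat}}) (pi : {fset nat}) : Prop :=
  [/\ fset0 \notin sigma, trivIfset sigma & fcover sigma = pi].

Definition partition_meet (sigma1 sigma2 : {fset {fset nat}}) :
    {fset {fset nat}} :=
  [fset A `&` B | A in sigma1, B in sigma2] `\ fset0.

Lemma partition_meetP (sigma1 sigma2 : {fset {fset nat}}) (pi : {fset nat}) :
  fset_partition sigma1 pi -> fset_partition sigma2 pi ->
  fset_partition (partition_meet sigma1 sigma2) pi.
Proof.
case=> _ /trivIfsetP tI1 cov1 [_ /trivIfsetP tI2 cov2].
have same (s : {fset {fset nat}}) p (A B : {fset nat}) :
    {in s &, forall A B : {fset nat}, A != B -> [disjoint A & B]} ->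
    A \in s -> B \in s -> p \in A -> p \in B -> A = B.
  move=> tI sA sB Ap Bp; apply/eqP; apply: contraT => /(tI _ _ sA sB).
  by move/fdisjointP/(_ p Ap); rewrite Bp.
split; first by rewrite !inE eqxx.
  apply/trivIfsetP=> X Y /fsetD1P[_ /imfset2P[A sA [B sB defX]]].
  case/fsetD1P=> _ /imfset2P[C sC [D sD defY]] neqXY; apply/fdisjointP=> p.
  subst X Y; rewrite inE => /andP[Ap Bp]; apply: contra neqXY.
  rewrite inE => /andP[Cp Dp].
  by rewrite (same _ p A C tI1) // (same _ p B D tI2).
apply/fsetP=> p; apply/bigfcupP/idP=> [[X /andP[]] | pi_p].
  case/fsetD1P=> _ /imfset2P[A sA [B sB ->]] _ /fsetIP[Ap _].
  by rewrite -cov1; apply/bigfcupP; exists A; rewrite ?andbT.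
have:= pi_p; rewrite -{1}cov1 => /bigfcupP[A /andP[sA _] Ap].
have:= pi_p; rewrite -cov2 => /bigfcupP[B /andP[sB _] Bp].
have ABp: p \in A `&` B by rewrite inE Ap.
exists (A `&` B) => //; rewrite andbT !inE; apply/andP; split.
  by apply: contraTneq ABp => ->; rewrite inE.
by apply/imfset2P; exists A => //; exists B.
Qed.

Definition block_pred (A : {fset nat}) : nat_pred := [pred p | p \in A].

Definition sigma_nilpotent (gT : finGroupType) (sigma : {fset {fset nat}})
    (G : {group gT}) : Prop :=
  forall A, A \in sigma ->
  exists K : {group gT}, K <| G /\ (block_pred A).-Hall(G) K.

(* [chief_factor G V U] says that U / V is a chief factor of G. *)
Definition sigma_soluble (gT : finGroupType) (sigma : {fset {fset nat}})
    (G : {group gT}) : Prop :=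
  forall U V : {group gT}, chief_factor G V U ->
  exists2 A, A \in sigma & (block_pred A).-group (U / V).

Definition sigma_subnormal_step (gT : finGroupType)
    (sigma : {fset {fset nat}}) (K L : {group gT}) : bool :=
  (K \subset L) &&
  ((K <| L) || has (fun A => (block_pred A).-group (L / gcore K L)) sigma).

Definition sigma_subnormal (gT : finGroupType) (sigma : {fset {fset nat}})
    (G H : {group gT}) : Prop :=
  exists2 c : seq {group gT},
    path (sigma_subnormal_step sigma) H c & last H c = G.

(* [P / N] is the image of P in G / N, that is, PN / N. *)
Definition pi_projector (gT : finGroupType) (pi : nat_pred)
    (G P : {group gT}) : Prop :=
  P \subset G /\
  forall N : {group gT}, N <| G ->
    [max P / N of Q | Q \subset G / N & pi.-group Q].

Definition sigma_p_permutable (gT : finGroupType) (sigma : {fset {fset nat}})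
    (G H : {group gT}) : Prop :=
  forall A, A \in sigma ->
  exists2 P : {group gT}, pi_projector (block_pred A) G P &
    forall x, x \in G -> H * (P :^ x) = (P :^ x) * H.

Definition sigma_property
    (theta : forall gT : finGroupType,
       {fset {fset nat}} -> {group gT} -> {group gT} -> Prop) : Prop :=
  forall (gT : finGroupType) (G H : {group gT}), H \subset G ->
    (forall sigma1 sigma2 : {fset {fset nat}},
        fset_partition sigma1 (prime_divisors #|G|) ->
        fset_partition sigma2 (prime_divisors #|G|) ->
        theta gT sigma1 G H -> theta gT sigma2 G H ->
        theta gT (partition_meet sigma1 sigma2) G H) /\
    (forall sigma : {fset {fset nat}},
        fset_partition sigma (prime_divisors #|G|) ->
        #|` sigma| = 1%N -> theta gT sigma G H).

(* Main.v *)
Require Import Defs.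
From mathcomp Require Import all_boot all_fingroup all_solvable.
From mathcomp Require Import finmap.

Set Implicit Arguments.
Unset Strict Implicit.
Unset Printing Implicit Defensive.
Import GroupScope.

(** For sigma-nilpotency and sigma-solubility one intersects normal Hall
    subgroups, respectively observes that a chief factor which is both an
    A-group and a B-group is an (A `&` B)-group.  If there is only one block,
    G itself is a group over that block and every claim is immediate.

    For sigma-subnormality, argue by induction on the index of H.  Restricting
    a chain to a subgroup, or joining it with a normal subgroup of G, gives a
    chain again.  Let M be the last proper member of one of the two chains and
    N its core (or M itself, if M is normal).  If N is not contained in H, then
    H < HN <= M < G and induction applies to both halves.  Otherwise this
    happens for neither chain; then either H is normal in G or G modulo the core
    of H is a group over one block of each partition, so that H reaches G in one
    step ([sigma_subnormal_meet]).

    For sigma-p-permutability write O^A(X) for the subgroup generated by the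
    A'-elements of X.  The key fact ([permutable_absorbing]) is that, if H
    permutes with all conjugates of a projector for every block, then
    O^A(HP) <= H for each such A-projector P.  It follows that modulo the core
    c of H in G the A-elements of H generate a subgroup of a normal A-subgroup
    of G ([absorbing_normal_closure]), while O^A(H) is normalised by all
    conjugates of P, hence by every A-element of G ([pgen_projector_norm]).

    Let now C = A `&` B, with A in the first partition and B in the second, and
    let R be any C-projector of G.  As R consists of elements that are both
    A-elements and B-elements, it normalises W = O^A(H) O^B(H) c.  The
    C-elements of H lie, modulo c, in a normal C-subgroup of G and therefore in
    R c, whereas the C'-elements of H generate a subgroup of W.  Hence
    H R = W R = R W = R H: H permutes with every C-projector, and it remains to
    know that C-projectors exist ([pi_projector_exists]).

    The key fact is proved by induction on the index of H.  If P does not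
    normalise H, replace H by the join H1 of H with a conjugate under P; it
    lies in HP and permutes with the same projectors.  Two observations bring
    the conclusion down from H1 to H.  First, H Q :&: H P = H for projectors P
    and Q of distinct blocks, because the index of H in this intersection
    divides both #|P| and #|Q|; in particular Q :&: HP <= H.  Secondly, if
    M <= HP is normal in G, then H :&: M = HQ :&: M is normalised by the
    projectors of all the other blocks, and this forces O^A(M) <= H
    ([normal_sub_perm_join]). *)

(** * The subgroup generated by pi-elements *)

Section Generation.

Variable gT : finGroupType.
Implicit Types (pi : nat_pred) (G H K L M N X : {group gT}).

(** This is O^{pi'}(H), the least normal subgroup of H with a pi'-quotient;
    generation by elements makes it monotone in both arguments. *)
Definition pgen pi (H : {set gT}) : {set gT} := <<[set x in H | pi.-elt x]>>.

Canonical pgen_group pi H := Eval hnf in [group of pgen pi H].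

Lemma mem_pgen pi H x : x \in H -> pi.-elt x -> x \in pgen pi H.
Proof. by move=> Hx pi_x; rewrite mem_gen // inE Hx. Qed.

Lemma pgenP pi H X :
  reflect {in H, forall x, pi.-elt x -> x \in X} (pgen pi H \subset X).
Proof.
rewrite gen_subG; apply: (iffP subsetP) => sHX x => [Hx pi_x | /setIdP[]].
  by rewrite sHX // inE Hx.
exact: sHX.
Qed.

Lemma pgen_sub pi H : pgen pi H \subset H.
Proof. exact/pgenP. Qed.

Lemma pgenS pi rho H K :
  {subset pi <= rho} -> H \subset K -> pgen pi H \subset pgen rho K.
Proof.
move=> s_pi_rho sHK; apply/pgenP=> x Hx pi_x; apply: mem_pgen.
  exact: (subsetP sHK).
exact: sub_p_elt pi_x.
Qed.

Lemma pgen_norm pi H : 'N(H) \subset 'N(pgen pi H).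
Proof.
apply/subsetP=> x nHx; rewrite inE -genJ genS //.
apply/subsetP=> _ /imsetP[y /setIdP[Hy pi_y] ->].
by rewrite inE memJ_norm // Hy p_eltJ.
Qed.

Lemma pgen_normal pi H : pgen pi H <| H.
Proof.
by rewrite /normal pgen_sub (subset_trans (normG H)) ?pgen_norm.
Qed.

Lemma normal_pgen pi H G : H <| G -> pgen pi H <| G.
Proof.
case/andP=> sHG nHG; rewrite /normal (subset_trans (pgen_sub _ _)) //.
exact: subset_trans nHG (pgen_norm _ _).
Qed.

(** Every Sylow p-subgroup with p in pi consists of pi-elements. *)
Lemma pgen_index pi H : pi^'.-nat #|H : pgen pi H|.
Proof.
apply/pnatP=> // p p_pr p_dv; apply/negP=> /= pi_p.
have [S sylS] := Sylow_exists p H; have [sSH pS _] := and3P sylS.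
have sSK : S \subset pgen pi H.
  apply/subsetP=> x Sx; apply: mem_pgen; first exact: (subsetP sSH).
  by apply: (pi_pnat (mem_p_elt pS Sx)).
have [_ _] := and3P sylS; rewrite p'natE // => /negP[].
exact: dvdn_trans p_dv (indexgS H sSK).
Qed.

(** An element is the product of its p-constituents. *)
Lemma pgen_prime_sub pi H X :
    (forall p x, p \in pi -> x \in H -> p.-elt x -> x \in X) ->
  pgen pi H \subset X.
Proof.
move=> sHX; apply/pgenP=> x Hx pi_x; rewrite -(prod_constt x).
apply: group_prod => p _; have [pi_p | pi'p] := boolP (p \in pi).
  apply: sHX pi_p _ (p_elt_constt _ _).
  by rewrite groupX.
suff -> : x.`_p = 1 by [].
apply/constt1P; apply: sub_p_elt pi_x => q pi_q.
by apply: contraNneq pi'p => <-.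
Qed.

Lemma index_norm_dvd H K L :
  H \subset 'N(K) -> H \subset L -> K \subset L -> #|H : K| %| #|L : K|.
Proof.
move=> nKH sHL sKL; have sHKL : H <*> K \subset L by rewrite join_subG sHL.
rewrite -(Lagrange_index sHKL (joing_subr H K)) dvdn_mull //.
by rewrite /= norm_joinEl // normC // indexMg.
Qed.

Lemma mem_of_index pi H N x :
  x \in 'N(N) -> x \in H -> N \subset H ->
  pi^'.-nat #|H : N| -> pi.-elt x -> x \in N.
Proof.
move=> nNx Hx sNH pi'iN pi_x; rewrite -cycle_subG.
have dv : #|<[x]> : N| %| #|H : N| by rewrite index_norm_dvd ?cycle_subG.
rewrite -indexg_eq1; apply/eqP/(@pnat_1 pi).
  exact: pnat_dvd (dvdn_indexg _ _) pi_x.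
exact: pnat_dvd dv pi'iN.
Qed.

Lemma pgen_index_sub pi H N :
  N <| H -> pi^'.-nat #|H : N| -> pgen pi H \subset N.
Proof.
case/andP=> sNH nNH pi'iN; apply/pgenP=> x Hx.
by apply: (mem_of_index _ Hx); rewrite ?(subsetP nNH).
Qed.

End Generation.

(** * Projectors and their existence *)

Section Projectors.

Variable gT : finGroupType.
Implicit Types (pi : nat_pred) (G H K N P R T X Y : {group gT}).

(** The maximality condition on P / N read in G itself, by the correspondence
    between subgroups of G / N and subgroups of G that contain N. *)
Lemma pi_projectorP pi G P :
  pi_projector pi G P <->
  [/\ P \subset G, pi.-group P
    & forall N T, N <| G -> N \subset T -> P \subset T -> T \subset G ->
      pi.-nat #|T : N| -> T \subset P * N].
Proof.
split=> [[sPG maxP] | [sPG piP maxP]]; split=> //.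
- have /maxgroupP[/andP[_]] := maxP _ (normal1 G).
  by rewrite /pgroup card_quotient ?norms1 // indexg1.
- move=> N T nsNG sNT sPT sTG pi_T.
  have /maxgroupP[_ maxPN] := maxP N nsNG.
  have nNT: T \subset 'N(N) := subset_trans sTG (normal_norm nsNG).
  have nNP := subset_trans sPT nNT.
  rewrite normC // -quotientSK // (maxPN (T / N)%G) ?quotientS //.
  by rewrite /= /pgroup card_quotient.
move=> N nsNG; have nNG := normal_norm nsNG.
apply/maxgroupP; split; first by rewrite quotientS ?quotient_pgroup.
move=> Q /andP[sQG piQ] sPQ; apply/eqP; rewrite eqEsubset sPQ andbT.
have [T defQ sNT sTG] := inv_quotientS nsNG sQG.
have nNT := subset_trans sTG nNG; have nNP := subset_trans sPG nNG.
move: piQ sPQ; rewrite defQ /pgroup card_quotient // => piT sPT.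
rewrite quotientSK // -normC //; apply: maxP => //.
by rewrite -(quotientSGK nNP sNT).
Qed.

Lemma pi_projector_sub_normal pi G P N X :
    pi_projector pi G P -> N <| G -> X <| G -> N \subset X ->
  pi.-nat #|X : N| -> X \subset P * N.
Proof.
case/pi_projectorP=> sPG piP maxP nsNG /andP[sXG nXG] sNX piX.
have nXP := subset_trans sPG nXG.
apply: subset_trans (joing_subr P X) _; apply: maxP; rewrite ?joing_subl //.
- exact: subset_trans sNX (joing_subr P X).
- by rewrite join_subG sPG.
rewrite -(Lagrange_index (joing_subr P X) sNX) pnatM piX andbT /=.
by rewrite norm_joinEl // normC // indexMg (pnat_dvd (dvdn_indexg _ _)).
Qed.

Lemma pi_projectorJ pi G P x :
  x \in G -> pi_projector pi G P -> pi_projector pi G (P :^ x).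
Proof.
move=> Gx /pi_projectorP[sPG piP maxP]; apply/pi_projectorP.
split=> [||N T nsNG]; [by rewrite -(conjGid Gx) conjSg | by rewrite pgroupJ |].
have nNx: N :^ x = N by rewrite (normsP (normal_norm nsNG)).
move=> sNT sPT sTG piT.
rewrite -nNx -conjsMg -sub_conjgV; apply: (maxP N (T :^ x^-1)%G) => //=.
- by rewrite -sub_conjg nNx.
- by rewrite -sub_conjg.
- by rewrite sub_conjgV conjGid.
by rewrite -{1}(conjsgK x N) nNx indexJg.
Qed.

(** The normal closure D of a pi-projector P contains all pi-elements x:
    in G / D the image of P is trivial and still a maximal pi-subgroup, so that
    G / D has no other pi-subgroup.  And D, generated by conjugates of P,
    normalises Y. *)
Lemma pgen_sub_projector_norm pi G P Y :
    pi_projector pi G P -> {in G, forall x, P :^ x \subset 'N(Y)} ->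
  pgen pi G \subset 'N(Y).
Proof.
move=> projP nYP; have /pi_projectorP[sPG _ maxP] := projP.
pose D := <<class_support P G>>%G.
have nsDG: D <| G.
  rewrite /normal gen_subG class_support_subG //=.
  by rewrite norms_gen // class_support_norm.
have sPD: P \subset D by rewrite sub_gen // sub_class_support.
have sDN: D \subset 'N(Y).
  rewrite gen_subG class_supportEr; apply/bigcupsP=> x Gx; exact: nYP.
apply: subset_trans sDN; apply/pgenP=> x Gx pi_x.
have nDx: <[x]> \subset 'N(D).
  by rewrite cycle_subG (subsetP (normal_norm nsDG)).
rewrite -cycle_subG; apply: subset_trans (joing_subl <[x]> D) _.
suff: <[x]> <*> D \subset P * D by rewrite (mulSGid sPD).
apply: maxP; rewrite ?joing_subr //.
- exact: subset_trans sPD (joing_subr _ _).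
- by rewrite join_subG cycle_subG Gx normal_sub.
by rewrite /= norm_joinEl // normC // indexMg (pnat_dvd (dvdn_indexg _ _)).
Qed.

(** A minimal supplement X is a pi-group.  Otherwise let S be a Sylow
    p-subgroup of X :&: N for some p outside pi that divides #|X|.  By the
    Frattini argument 'N_X(S) is again a supplement, so S is normal in X, and
    it is a Sylow subgroup of X as the index of X :&: N is a pi-number.  Its
    Schur-Zassenhaus complement is then a smaller supplement. *)
Lemma exists_pi_supplement pi G N :
    N <| G -> pi.-nat #|G : N| ->
  exists2 X : {group gT}, X \subset G & pi.-group X /\ N * X = G.
Proof.
case/andP=> sNG nNG piG.
pose supp X := (X \subset G) && (N * X == G).
have: supp G by rewrite /supp subxx mulSGid /=.
case/mingroup_exists=> X /mingroupP[/andP[sXG /eqP defG] minX] _.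
exists X => //; split=> //.
apply/pgroupP=> p p_pr p_dv_X; apply/idPn=> pi'p.
have nND: X :&: N <| X by rewrite (normalGI sXG) // /normal sNG.
have piX: pi.-nat #|X : X :&: N| by rewrite indexgI -indexMg defG.
have [S sylS] := Sylow_exists p (X :&: N)%G.
have [sSD pS _] := and3P sylS; have [sSX sSN] := subsetIP sSD.
have minS (Y : {group gT}): Y \subset X -> X \subset N * Y -> Y :=: X.
  move=> sYX sXNY; apply: minX => //; rewrite /supp (subset_trans sYX sXG) /=.
  have sYG := subset_trans sYX sXG.
  rewrite eqEsubset -{1}(mulSGid sNG) mulgS //= -{1}defG.
  by rewrite -{2}(mulGid N) -mulgA mulgS.
have nSX: 'N_X(S) = X.
  apply: minS (subsetIl _ _) _.
  by rewrite -{1}(Frattini_arg nND sylS) mulSg // subsetIr.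
have sylSX: p.-Sylow(X) S.
  rewrite /pHall sSX pS -(Lagrange_index (subsetIl X N) sSD) pnatM.
  case/and3P: sylS => _ _ ->; rewrite andbT; apply: sub_in_pnat piX => q _.
  by move=> pi_q; apply: contraNneq pi'p => <-.
have nsSX: S <| X by rewrite /normal sSX -{1}nSX subsetIr.
have splitX := SchurZassenhaus_split (pHall_Hall sylSX) nsSX.
have /splitsP[Y /complP[tiSY defX]] := splitX.
have sYX: Y \subset X by rewrite -defX mulG_subr.
have eqYX: Y :=: X by apply: minS => //; rewrite -{1}defX mulSg.
have S1: S :=: 1 by rewrite -tiSY eqYX (setIidPl sSX).
have := card_Hall sylSX; rewrite S1 cards1 => /esym/eqP.
by rewrite p_part_eq1 mem_primes p_pr cardG_gt0 p_dv_X.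
Qed.

(** The hypotheses on R say that R / N is a projector of G / N, in terms of
    subgroups of G.  Given a pi-section T / K with P <= T, it yields
    T <= R K, so T = (T :&: R) K, and T :&: R is controlled by P. *)
Lemma pi_projector_lift pi G N R P :
    N <| G -> N \subset R -> R \subset G -> pi.-nat #|R : N| ->
    (forall K T, K <| G -> N \subset K -> K \subset T -> R \subset T ->
       T \subset G -> pi.-nat #|T : K| -> T \subset R * K) ->
  pi_projector pi R P -> pi_projector pi G P.
Proof.
move=> nsNG sNR sRG piR maxR projP; have /pi_projectorP[sPR piP maxP] := projP.
have nsNR := normalS sNR sRG nsNG.
have defR: R \subset P * N.
  exact: (pi_projector_sub_normal projP nsNR (normal_refl R)).
apply/pi_projectorP; split=> // [|K T nsKG sKT sPT sTG piT].
  exact: subset_trans sRG.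
have [nNG nKG] := (normal_norm nsNG, normal_norm nsKG).
have nKT := subset_trans sTG nKG; have nKP := subset_trans sPT nKT.
have nsKN: K <*> N <| G by rewrite normalY.
have nKNT := subset_trans sTG (normal_norm nsKN).
have sTRK: T \subset R * K.
  have defKN: R * (K <*> N) = R * K.
    have nNK := subset_trans (normal_sub nsKG) nNG.
    by rewrite norm_joinEl // (normC nNK) mulgA (mulGSid sNR).
  apply: subset_trans (joing_subl T (K <*> N)) _; rewrite -defKN.
  apply: maxR => //; rewrite ?joing_subr //.
  - apply: subset_trans defR _; rewrite mul_subG //.
      exact: subset_trans sPT (joing_subl _ _).
    exact: subset_trans (joing_subr K N) (joing_subr _ _).
  - by rewrite join_subG sTG normal_sub.
  rewrite /= (norm_joinEl nKNT) (normC nKNT) indexMg.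
  by apply: pnat_dvd piT; rewrite indexgS ?joing_subl.
have sTRP: T :&: R \subset P * (K :&: R).
  apply: maxP; rewrite ?subsetIr ?setSI // ?subsetI ?sPT //.
    by rewrite /= setIC (normalGI sRG).
  rewrite /= (_ : K :&: R = (T :&: R) :&: K); last first.
    by rewrite setIAC (setIidPr sKT).
  rewrite indexgI (pnat_dvd _ piT) // index_norm_dvd ?subsetIl //.
  by rewrite subIset ?nKT.
have: T \subset T :&: R * K by rewrite subsetI sTRK subxx.
rewrite -group_modr // => /subset_trans; apply.
rewrite -{2}(mulGid K) mulgA mulSg //.
by apply: subset_trans sTRP _; rewrite mulgS ?subsetIl.
Qed.

End Projectors.

(** Induction on #|G|: let N be a minimal normal subgroup and R / N a projector
    of G / N.  If R is proper, a projector of R is one of G.  If R = G, then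
    G / N is a pi-group, and any maximal pi-subgroup P with P N = G works: a
    normal subgroup K either contains N, so that P K = G, or meets N trivially
    and is then a pi-group, contained in P. *)
Theorem pi_projector_exists pi gT (G : {group gT}) :
  exists P : {group gT}, pi_projector pi G P.
Proof.
have [n leGn] := ubnP #|G|.
elim: n => // n IHn in gT G leGn *; rewrite ltnS in leGn.
have [G1 | ntG] := eqVneq (G : {set gT}) 1.
  exists G; apply/pi_projectorP; split=> // [|N T _ _ _ sTG _].
    by rewrite G1 pgroup1.
  exact: subset_trans sTG (mulG_subl _ _).
have [N minN sNG] := minnormal_exists ntG (normG G).
have [/andP[ntN nNG] minN'] := mingroupP minN.
have nsNG: N <| G by apply/andP.
have [|Rb projRb] := IHn _ (G / N)%G.
  exact: leq_trans (ltn_quotient ntN sNG) leGn.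
have /pi_projectorP[sRbG piRb maxRb] := projRb.
have [R defRb sNR sRG] := inv_quotientS nsNG sRbG.
have nNR := subset_trans sRG nNG.
have piR: pi.-nat #|R : N| by rewrite -card_quotient // -defRb.
have [eqRG | neRG] := eqVneq (R : {set gT}) G; last first.
  have [|P projP] := IHn _ R.
    by apply: leq_trans leGn; rewrite proper_card // properEneq neRG.
  exists P; apply: (pi_projector_lift nsNG sNR sRG piR) projP.
  move=> K T nsKG sNK sKT sRT sTG piT.
  have nNT := subset_trans sTG nNG; have nNK := subset_trans sKT nNT.
  rewrite -(mulSGid sNR) -mulgA -quotientSK //.
  rewrite quotientMl // -defRb; apply: maxRb; rewrite ?quotient_normal //.
  - exact: quotientS.
  - by rewrite defRb quotientS.
  - exact: quotientS.
  by rewrite index_quotient_eq // subIset // sNK orbT.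
rewrite eqRG in piR.
have [X sXG [piX defG]] := exists_pi_supplement nsNG piR.
pose piG (P : {group gT}) := (P \subset G) && pi.-group P.
have: piG X by rewrite /piG sXG.
case/maxgroup_exists=> P /maxgroupP[/andP[sPG piP] maxP] sXP.
exists P; apply/pi_projectorP; split=> // K T nsKG sKT sPT sTG piT.
have nKG := normal_norm nsKG.
have [KN1 | ntKN] := eqVneq (K :&: N) 1; last first.
  have sNK: N \subset K.
    by rewrite -(minN' (K :&: N)%G) ?subsetIl ?subsetIr // ntKN normsI.
  rewrite (subset_trans sTG) // -defG -normC ?mulgSS //.
  exact: subset_trans sXG nNG.
rewrite (subset_trans _ (mulG_subl K P)) // (maxP T) // /piG sTG /pgroup /=.
rewrite -(Lagrange sKT) pnatM piT andbT.
rewrite -(LagrangeI K N) KN1 cards1 mul1n.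
rewrite (pnat_dvd _ piR) // index_norm_dvd // (subset_trans sKT) //.
exact: subset_trans sTG nNG.
Qed.

(** * Blocks of a meet of partitions *)

Section Meet.

Implicit Types (A B : {fset nat}) (sigma : {fset {fset nat}}).

Lemma mem_partition_meet sigma1 sigma2 A B p :
    A \in sigma1 -> B \in sigma2 -> p \in A -> p \in B ->
  (A `&` B)%fset \in partition_meet sigma1 sigma2.
Proof.
move=> sA sB Ap Bp; apply/fsetD1P; split.
  by apply/fset0Pn; exists p; rewrite inE Ap.
by apply/imfset2P; exists A => //; exists B.
Qed.

Lemma partition_meet_blocks sigma1 sigma2 C :
    C \in partition_meet sigma1 sigma2 ->
  exists A B, [/\ A \in sigma1, B \in sigma2 & C = (A `&` B)%fset].
Proof. by case/fsetD1P=> _ /imfset2P[A sA [B sB ->]]; exists A, B. Qed.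

Lemma block_pred_meet A B n :
  (block_pred (A `&` B)%fset).-nat n
    = (block_pred A).-nat n && (block_pred B).-nat n.
Proof.
rewrite /pnat andbACA andbb -all_predI; congr (_ && _).
by apply: eq_all => p; rewrite !inE.
Qed.

(** The condition 1 < n excludes disjoint blocks, whose empty intersection is
    not a block of the meet. *)
Lemma partition_meet_pnat sigma1 sigma2 A B n :
    A \in sigma1 -> B \in sigma2 -> (1 < n)%N ->
    (block_pred A).-nat n -> (block_pred B).-nat n ->
  exists2 C, C \in partition_meet sigma1 sigma2 & (block_pred C).-nat n.
Proof.
move=> sA sB n_gt1 An Bn; exists (A `&` B)%fset; last first.
  by rewrite block_pred_meet An.
have n_p : pdiv n \in \pi(n) by rewrite pi_pdiv.
exact: (mem_partition_meet sA sB (pnatPpi An n_p) (pnatPpi Bn n_p)).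
Qed.

Lemma single_block_group (gT : finGroupType) (G : {group gT}) sigma :
    fset_partition sigma (prime_divisors #|G|) -> #|` sigma| = 1%N ->
  exists2 A, sigma = [fset A]%fset & (block_pred A).-group G.
Proof.
case=> _ _ covG /eqP/cardfs1P[A defs]; exists A => //.
apply/pgroupP=> p p_pr p_dv; rewrite inE.
have: p \in prime_divisors #|G| by rewrite inE /= mem_primes p_pr cardG_gt0.
by rewrite -covG => /bigfcupP[B /andP[]]; rewrite defs inE => /eqP->.
Qed.

End Meet.

(** * Subnormality *)

Section Subnormality.

Variable gT : finGroupType.
Implicit Types (sigma : {fset {fset nat}}) (G H K L M N X : {group gT}).

Lemma sigma_step_core sigma K L N A :
    A \in sigma -> N \subset K -> K \subset L -> N <| L ->
  (block_pred A).-nat #|L : N| -> sigma_subnormal_step sigma K L.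
Proof.
move=> sA sNK sKL nsNL piN; rewrite /sigma_subnormal_step sKL /=.
apply/orP; right; apply/hasP; exists A => //.
rewrite /pgroup card_quotient ?gcore_norm //.
by apply: pnat_dvd piN; rewrite indexgS // gcore_max ?normal_norm.
Qed.

Lemma sigma_step_normal sigma K L : K <| L -> sigma_subnormal_step sigma K L.
Proof. by move=> nsKL; rewrite /sigma_subnormal_step normal_sub ?nsKL. Qed.

(** N is a normal subgroup of L below K that witnesses the step: K itself when
    K is normal, the core of K otherwise.  Having N = K as an alternative lets
    the induction below treat both kinds of steps alike. *)
Lemma sigma_stepP sigma K L :
    sigma_subnormal_step sigma K L ->
  K \subset L /\ exists N, [/\ N <| L, N \subset K
    & N :=: K \/ exists2 A, A \in sigma & (block_pred A).-nat #|L : N|].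
Proof.
case/andP=> sKL step; split=> //; case/orP: step => [nsKL | /hasP[A sA piA]].
  by exists K; split=> //; left.
exists (gcore_group K L); split; rewrite ?gcore_normal ?gcore_sub //.
by right; exists A => //; rewrite -card_quotient ?gcore_norm.
Qed.

Lemma sigma_step_cap sigma K L X :
  sigma_subnormal_step sigma K L ->
  sigma_subnormal_step sigma (K :&: X)%G (L :&: X)%G.
Proof.
case/sigma_stepP=> sKL [N [nsNL sNK casesN]].
have sLX : (L :&: X)%G \subset L := subsetIl L X.
have nsNX : N :&: X <| L :&: X.
  rewrite /normal setSI ?(normal_sub nsNL) // normsI //.
    exact: subset_trans sLX (normal_norm nsNL).
  exact: subset_trans (subsetIr L X) (normG X).
case: casesN => [eqNK | [A sA piN]].
  by apply: sigma_step_normal; rewrite /= -eqNK.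
apply: (@sigma_step_core _ _ _ (N :&: X)%G A) => //=; rewrite ?setSI //.
have ->: N :&: X = (L :&: X) :&: N.
  by rewrite setIAC (setIidPr (normal_sub nsNL)).
rewrite indexgI (pnat_dvd _ piN) // index_norm_dvd // ?(normal_sub nsNL) //.
exact: subset_trans sLX (normal_norm nsNL).
Qed.

Lemma sigma_step_join sigma K L N :
    L \subset 'N(N) -> sigma_subnormal_step sigma K L ->
  sigma_subnormal_step sigma (K <*> N)%G (L <*> N)%G.
Proof.
move=> nNL /sigma_stepP[sKL [D [nsDL sDK casesD]]].
have nsDN (E : {group gT}): E <| L -> E <*> N <| L <*> N.
  case/andP=> sEL nEL; rewrite /normal genS ?setSU //= join_subG.
  rewrite normsY // /= (subset_trans (joing_subr E N) (normG _)) //.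
have sKN : K <*> N \subset L <*> N by rewrite genS ?setSU.
case: casesD => [eqDK | [A sA piD]].
  by apply: sigma_step_normal; apply: nsDN; rewrite -eqDK.
apply: (@sigma_step_core _ _ _ (D <*> N)%G A) => //.
- by rewrite genS ?setSU.
- exact: nsDN.
have nDN : D <*> N <| L <*> N := nsDN D nsDL.
rewrite /=; have ->: L <*> N = L <*> (D <*> N).
  by rewrite joingA (joing_idPl (normal_sub nsDL)).
have nL : L \subset 'N(D <*> N).
  exact: subset_trans (joing_subl L N) (normal_norm nDN).
rewrite (norm_joinEl nL) (normC nL) indexMg.
by rewrite (pnat_dvd _ piD) // indexgS ?joing_subl.
Qed.

Lemma sigma_subnormal_refl sigma G : sigma_subnormal sigma G G.
Proof. by exists [::]. Qed.

Lemma sigma_subnormal_cons sigma G H K :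
    sigma_subnormal_step sigma H K -> sigma_subnormal sigma G K ->
  sigma_subnormal sigma G H.
Proof.
by move=> stepHK [c pathc lastc]; exists (K :: c) => //=; rewrite stepHK.
Qed.

Lemma sigma_subnormal1 sigma G H :
  sigma_subnormal_step sigma H G -> sigma_subnormal sigma G H.
Proof. by move/sigma_subnormal_cons; apply; apply: sigma_subnormal_refl. Qed.

Lemma sigma_subnormal_ind sigma G (P : {group gT} -> Prop) :
    P G ->
    (forall H K, sigma_subnormal_step sigma H K -> sigma_subnormal sigma G K ->
       P K -> P H) ->
  forall H, sigma_subnormal sigma G H -> P H.
Proof.
move=> PG Pstep H [c]; elim: c H => [H _ /= -> //|K c IHc] H /=.
case/andP=> sHK pathc lastc.
by apply: Pstep sHK _ (IHc K pathc lastc); exists c.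
Qed.

Lemma sigma_subnormal_trans sigma G H K :
    sigma_subnormal sigma K H -> sigma_subnormal sigma G K ->
  sigma_subnormal sigma G H.
Proof.
move=> snHK snKG; elim/sigma_subnormal_ind: H / snHK => // H L stepHL _.
exact: sigma_subnormal_cons.
Qed.

Lemma sigma_subnormal_sub sigma G H : sigma_subnormal sigma G H -> H \subset G.
Proof.
elim/sigma_subnormal_ind=> {H} // H K /andP[sHK _] _; exact: subset_trans.
Qed.

Lemma sigma_subnormal_cap sigma G H X :
  sigma_subnormal sigma G H -> sigma_subnormal sigma (G :&: X)%G (H :&: X)%G.
Proof.
elim/sigma_subnormal_ind=> {H} [|H K stepHK _].
  exact: sigma_subnormal_refl.
by apply: sigma_subnormal_cons; apply: sigma_step_cap.
Qed.

Lemma sigma_subnormal_join sigma G H N :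
    N <| G -> sigma_subnormal sigma G H ->
  sigma_subnormal sigma G (H <*> N)%G.
Proof.
move=> nsNG; have [sNG nNG] := andP nsNG.
elim/sigma_subnormal_ind=> {H} [|H K stepHK snK].
  have ->: (G <*> N)%G = G by apply: val_inj; apply/joing_idPl.
  exact: sigma_subnormal_refl.
apply: sigma_subnormal_cons; apply: sigma_step_join stepHK.
exact: subset_trans (sigma_subnormal_sub snK) nNG.
Qed.

Lemma sigma_subnormal_last sigma G H :
    sigma_subnormal sigma G H -> H != G ->
  exists M, [/\ sigma_subnormal sigma M H, sigma_subnormal_step sigma M G
               & M != G].
Proof.
elim/sigma_subnormal_ind=> {H} [|H K stepHK snK IHK] neHG.
  by case/eqP: neHG.
have [eqKG | /IHK[M [snKM stepM neMG]]] := eqVneq K G.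
  by exists H; split=> //; [apply: sigma_subnormal_refl | rewrite -eqKG].
by exists M; split=> //; apply: sigma_subnormal_cons snKM.
Qed.

(** Induction on the index of H.  A witness N of the last step of either chain
    which is not contained in H gives an intermediate subgroup HN, through
    which H is reached by induction; if both witnesses are contained in H, their
    join gives a single step from H to G. *)
Theorem sigma_subnormal_meet sigma1 sigma2 G H :
    sigma_subnormal sigma1 G H -> sigma_subnormal sigma2 G H ->
  sigma_subnormal (partition_meet sigma1 sigma2) G H.
Proof.
have [n] := ubnP #|G : H|; elim: n => // n IHn in G H *.
rewrite ltnS => leGHn sn1 sn2; have sHG := sigma_subnormal_sub sn1.
have [-> | neHG] := eqVneq H G; first exact: sigma_subnormal_refl.
have through sigma N M : sigma_subnormal sigma M H ->
    sigma_subnormal_step sigma M G -> M != G -> N <| G -> N \subset M ->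
    ~~ (N \subset H) -> sigma_subnormal (partition_meet sigma1 sigma2) G H.
  move=> snHM /andP[sMG _] neMG nsNG sNM not_sNH; pose X := (H <*> N)%G.
  have sHX : H \subset X := joing_subl H N.
  have sXM : X \subset M by rewrite join_subG (sigma_subnormal_sub snHM).
  have sXG := subset_trans sXM sMG.
  have ltHX : H \proper X.
    rewrite properE sHX; apply: contra not_sNH.
    exact/subset_trans/joing_subr.
  have ltXG : X \proper G.
    rewrite properE sXG; apply: contra neMG => sGX.
    by rewrite -val_eqE eqEsubset sMG (subset_trans sGX).
  have snX sigma' : sigma_subnormal sigma' G H -> sigma_subnormal sigma' X H.
    move=> snH; have:= sigma_subnormal_cap X snH.
    have -> : (G :&: X)%G = X by apply/val_inj/setIidPr.
    by have -> : (H :&: X)%G = H by apply/val_inj/setIidPl.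
  have iXH : #|G : H| = (#|G : X| * #|X : H|)%N by rewrite Lagrange_index.
  have [iX1 iH1] : (1 < #|G : X|)%N /\ (1 < #|X : H|)%N.
    by rewrite !indexg_gt1 !proper_subn.
  apply: (@sigma_subnormal_trans _ _ _ X); apply: IHn; try exact: snX;
    try exact: sigma_subnormal_join; apply: leq_trans leGHn; rewrite iXH.
    by rewrite ltn_Pmull.
  by rewrite ltn_Pmulr.
have [M1 [snM1 stepM1 neM1G]] := sigma_subnormal_last sn1 neHG.
have [M2 [snM2 stepM2 neM2G]] := sigma_subnormal_last sn2 neHG.
have [_ [N1 [nsN1 sN1M1 casesN1]]] := sigma_stepP stepM1.
have [_ [N2 [nsN2 sN2M2 casesN2]]] := sigma_stepP stepM2.
have [sN1H | not_sN1H] := boolP (N1 \subset H); last first.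
  exact: through snM1 stepM1 neM1G nsN1 sN1M1 not_sN1H.
have [sN2H | not_sN2H] := boolP (N2 \subset H); last first.
  exact: through snM2 stepM2 neM2G nsN2 sN2M2 not_sN2H.
have normalH N M sigma : sigma_subnormal sigma M H -> N <| G ->
    N \subset H -> N :=: M ->
    sigma_subnormal (partition_meet sigma1 sigma2) G H.
  move=> snHM nsNG sNH eqNM; apply/sigma_subnormal1/sigma_step_normal.
  suff ->: H :=: N by [].
  by apply/eqP; rewrite eqEsubset sNH eqNM (sigma_subnormal_sub snHM).
case: casesN1 => [eqNM | [A sA piA]].
  exact: normalH snM1 nsN1 sN1H eqNM.
case: casesN2 => [eqNM | [B sB piB]].
  exact: normalH snM2 nsN2 sN2H eqNM.
have sNH : N1 <*> N2 \subset H by rewrite join_subG sN1H.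
have nsNG : N1 <*> N2 <| G by rewrite normalY.
have iN : (1 < #|G : N1 <*> N2|)%N.
  rewrite indexg_gt1; apply: contra neHG => sGN.
  by rewrite -val_eqE eqEsubset sHG (subset_trans sGN).
have piN1 : (block_pred A).-nat #|G : N1 <*> N2|.
  by rewrite (pnat_dvd _ piA) // indexgS ?joing_subl.
have piN2 : (block_pred B).-nat #|G : N1 <*> N2|.
  by rewrite (pnat_dvd _ piB) // indexgS ?joing_subr.
have [C sC piC] := partition_meet_pnat sA sB iN piN1 piN2.
exact/sigma_subnormal1/(sigma_step_core sC sNH sHG nsNG).
Qed.

End Subnormality.

(** * Subgroups permuting with projectors *)

Section Permutability.

Variable gT : finGroupType.
Implicit Types (pi rho : nat_pred) (G H K M N P Q R V X Y : {group gT}).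

(** The elements x with x P <= P (H <*> K) form a group. *)
Lemma commute_joing H K P :
  commute H P -> commute K P -> commute (H <*> K) P.
Proof.
move=> cHP cKP; pose J := (H <*> K)%G.
suff: commute J P by [].
pose S := [set x | x *: P \subset P * J].
have gS: group_set S.
  apply/group_setP; split=> [|x y]; rewrite !inE.
    by rewrite lcoset1 mulG_subl.
  move=> sxP syP; rewrite lcosetM; apply: subset_trans (mulgS _ syP) _.
  by rewrite mulgA -{2}(mulGid J) mulgA mulSg.
have sJS: J \subset S.
  rewrite (gen_subG _ (Group gS)) subUset; apply/andP; split; apply/subsetP=> x.
    move=> Hx; rewrite inE (subset_trans (B := H * P)) ?mulSg ?sub1set //.
    by rewrite cHP mulgS ?joing_subl.
  move=> Kx; rewrite inE (subset_trans (B := K * P)) ?mulSg ?sub1set //.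
  by rewrite cKP mulgS ?joing_subr.
apply/eqP; rewrite eqEcard; apply/andP; split.
  apply/subsetP=> _ /mulsgP[x y Jx Py ->].
  have:= subsetP sJS x Jx; rewrite inE => /subsetP; apply.
  by rewrite mem_lcoset mulKg.
by rewrite -card_invg invMG.
Qed.

(** The index of H in the intersection divides both #|P| and #|Q|. *)
Lemma commute_capI pi rho H P Q :
    {subset pi <= rho^'} -> pi.-group P -> rho.-group Q ->
    commute H P -> commute H Q ->
  (H <*> P) :&: (H <*> Q) \subset H.
Proof.
move=> pi_rho' piP rhoQ cHP cHQ; rewrite -indexg_eq1.
have sHD: H \subset (H <*> P) :&: (H <*> Q) by rewrite subsetI !joing_subl.
apply/eqP/(@pnat_1 rho).
  apply: pnat_dvd (indexSg sHD (subsetIr _ _)) _.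
  by rewrite /= comm_joingE // indexMg (pnat_dvd (dvdn_indexg _ _)).
apply: pnat_dvd (indexSg sHD (subsetIl _ _)) _.
rewrite /= comm_joingE // indexMg (pnat_dvd (dvdn_indexg _ _)) //.
by apply: sub_in_pnat piP => p _; apply: pi_rho'.
Qed.

Section OnePartition.

Variables (G : {group gT}) (sigma : {fset {fset nat}}).
Hypothesis partG : fset_partition sigma (prime_divisors #|G|).
Implicit Types A B : {fset nat}.

Definition perm_projector A H P :=
  pi_projector (block_pred A) G P /\ {in G, forall x, commute H (P :^ x)}.

Lemma sigma_p_permutableP H :
  sigma_p_permutable sigma G H <->
  {in sigma, forall A, exists P, perm_projector A H P}.
Proof.
by split=> permH A sA; have [P] := permH A sA; [exists P | case; exists P].
Qed.

Lemma block_disjoint A B p :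
  A \in sigma -> B \in sigma -> B != A -> p \in B -> p \notin A.
Proof.
case: partG => _ /trivIfsetP tI _ sA sB neBA pB; apply/negP=> pA.
by have /fdisjointP/(_ p pB) := tI _ _ sB sA neBA; rewrite pA.
Qed.

Lemma block_exists p : prime p -> p %| #|G| -> exists2 A, A \in sigma & p \in A.
Proof.
move=> p_pr p_dv; have: p \in prime_divisors #|G|.
  by rewrite inE /= mem_primes p_pr cardG_gt0.
case: partG => _ _ <- /bigfcupP[A /andP[sA _] pA]; by exists A.
Qed.

(** An A'-element is a product of elements of prime power order, and each prime
    involved lies in a block other than A. *)
Lemma pgen_compl_sub A H X :
    H \subset G ->
    {in sigma, forall B, B != A -> pgen (block_pred B) H \subset X} ->
  pgen (block_pred A)^' H \subset X.
Proof.
move=> sHG sBX; apply: pgen_prime_sub => p x A'p Hx p_x.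
have [x1 | nt_x] := eqVneq x 1; first by rewrite x1.
have [|p_pr p_dv _] := pgroup_pdiv p_x; first by rewrite cycle_eq1.
have [|B sB pB] := block_exists p_pr.
  apply: dvdn_trans p_dv _; apply: cardSg.
  by rewrite cycle_subG (subsetP sHG).
apply: (subsetP (sBX B sB _)).
  by apply: contraNneq A'p => <-.
apply: mem_pgen Hx _; exact: pi_pnat p_x _.
Qed.

Lemma perm_projectorJ A H P x :
  x \in G -> perm_projector A H P -> perm_projector A H (P :^ x).
Proof.
move=> Gx [projP cHP]; split; first exact: pi_projectorJ.
by move=> y Gy; rewrite -conjsgM; apply: cHP; rewrite groupM.
Qed.

Lemma perm_projector_commute A H P : perm_projector A H P -> commute H P.
Proof. by case=> _ /(_ 1 (group1 G)); rewrite conjsg1. Qed.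

Lemma perm_projector_sub A H P : perm_projector A H P -> P \subset G.
Proof. by case=> [[]]. Qed.

Lemma perm_projector_group A H P :
  perm_projector A H P -> (block_pred A).-group P.
Proof. by case=> /pi_projectorP[]. Qed.

Lemma perm_projector_capI A B H P Q :
    A \in sigma -> B \in sigma -> B != A ->
    perm_projector A H Q -> perm_projector B H P ->
  (H <*> P) :&: (H <*> Q) \subset H.
Proof.
move=> sA sB neBA permQ permP.
apply: (@commute_capI (block_pred B) (block_pred A)).
- by move=> p; apply: block_disjoint.
- exact: perm_projector_group permP.
- exact: perm_projector_group permQ.
- exact: perm_projector_commute permP.
exact: perm_projector_commute permQ.
Qed.

(** For P in another block, H :&: M = HP :&: M since HP :&: HQ = H; so P
    normalises H :&: M.  Therefore all A'-elements of G do.  As H :&: M has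
    A-index in M, an A'-element of M which normalises it lies in it. *)
Lemma normal_sub_perm_join A H Q M :
    H \subset G -> sigma_p_permutable sigma G H ->
    A \in sigma -> perm_projector A H Q -> M <| G -> M \subset H <*> Q ->
  pgen (block_pred A)^' M \subset H.
Proof.
move=> sHG /sigma_p_permutableP permH sA permQ nsMG sMHQ.
have [sMG nMG] := andP nsMG.
have nY: pgen (block_pred A)^' G \subset 'N(H :&: M).
  apply: pgen_compl_sub => // B sB neBA; have [P permP] := permH B sB.
  apply: pgen_sub_projector_norm permP.1 _ => x Gx.
  have permPx := perm_projectorJ Gx permP; rewrite /=.
  have ->: H :&: M = (H <*> P :^ x) :&: M.
    apply/eqP; rewrite eqEsubset setSI ?joing_subl // subsetI subsetIr andbT.
    apply: subset_trans (perm_projector_capI sA sB neBA permQ permPx).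
    by rewrite setIS.
  rewrite normsI ?(subset_trans (joing_subr _ _) (normG _)) //.
  exact: subset_trans (perm_projector_sub permPx) nMG.
apply/pgenP=> x Mx A'x.
suff: x \in H :&: M by case/setIP.
apply: (mem_of_index (pi := (block_pred A)^') (H := M)) => //; last 1 first.
- rewrite pnatNK /= setIC indexgI -indexMg.
  have cHM: H * M = H <*> M by rewrite norm_joinEl // (subset_trans sHG).
  rewrite cHM; apply: (@pnat_dvd _ #|H <*> Q : H|).
    by rewrite indexSg ?joing_subl // join_subG joing_subl.
  rewrite comm_joingE ?indexMg; last exact: perm_projector_commute permQ.
  exact: pnat_dvd (dvdn_indexg _ _) (perm_projector_group permQ).
- by apply: (subsetP nY); rewrite mem_pgen // (subsetP sMG).
exact: subsetIr.
Qed.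

(** Equivalently, HP modulo the core of H in HP is an A-group.  Quantifying over
    all projectors P whose conjugates permute with H allows H to be enlarged
    while P is kept. *)
Definition absorbing H :=
  forall A P, A \in sigma -> perm_projector A H P ->
    pgen (block_pred A)^' (H <*> P) \subset H.

Lemma absorbing_eq H A P :
    absorbing H -> A \in sigma -> perm_projector A H P ->
  pgen (block_pred A)^' H = pgen (block_pred A)^' (H <*> P).
Proof.
move=> absH sA permP; apply/eqP; rewrite eqEsubset pgenS ?joing_subl //=.
apply/pgenP=> x HPx A'x; apply: mem_pgen => //.
by apply: (subsetP (absH A P sA permP)); apply: mem_pgen.
Qed.

Lemma absorbing_norm H A P :
    absorbing H -> A \in sigma -> perm_projector A H P ->
  P \subset 'N(pgen (block_pred A)^' H).
Proof.
move=> absH sA permP; rewrite (absorbing_eq absH sA permP).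
exact: subset_trans (joing_subr H P) (normal_norm (pgen_normal _ _)).
Qed.

(** O^A(H) = O^A(HP) is normalised by every conjugate of P, and these generate
    a subgroup containing all A-elements of G. *)
Lemma pgen_projector_norm H A :
    sigma_p_permutable sigma G H -> absorbing H -> A \in sigma ->
  pgen (block_pred A) G \subset 'N(pgen (block_pred A)^' H).
Proof.
move=> /sigma_p_permutableP permH absH sA; have [P permP] := permH A sA.
apply: pgen_sub_projector_norm permP.1 _ => x Gx.
exact: absorbing_norm absH sA (perm_projectorJ Gx permP).
Qed.

(** Let K be generated by the A-elements of H.  For a block B other than A, K is
    also generated by the A-elements of O^B(H), so K is normalised by all
    B-projectors that permute with H, whence by O^A(G).  As an A-projector P
    covers G / O^A(G), the normal closure V of K in G is already its closure
    under P, so V <= HP.  Then O^A(V) <= O^A(HP) <= H, and O^A(V) is normal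
    in G. *)
Lemma absorbing_normal_closure H A :
    H \subset G -> sigma_p_permutable sigma G H -> absorbing H ->
    A \in sigma ->
  exists V, [/\ V <| G, pgen (block_pred A) H \subset V
               & pgen (block_pred A)^' V \subset gcore H G].
Proof.
move=> sHG /sigma_p_permutableP permH absH sA; have [P permP] := permH A sA.
pose K := pgen_group (block_pred A) H.
have nK: pgen (block_pred A)^' G \subset 'N(K).
  apply: pgen_compl_sub => // B sB neBA; have [Q permQ] := permH B sB.
  apply: pgen_sub_projector_norm permQ.1 _ => x Gx.
  have nLQ := absorbing_norm absH sB (perm_projectorJ Gx permQ).
  suff ->: K :=: pgen (block_pred A) (pgen (block_pred B)^' H)%G.
    exact: subset_trans nLQ (pgen_norm _ _).
  apply/eqP; rewrite eqEsubset.
  rewrite (pgenS (H := pgen_group _ H) _ (pgen_sub _ _)) // andbT.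
  apply/pgenP=> y Hy A_y; apply: mem_pgen => //=.
  apply: mem_pgen => //; apply: sub_p_elt A_y => p.
  by apply: block_disjoint => //; rewrite eq_sym.
have nsDG := pgen_normal (block_pred A)^' G.
have defG: G \subset P * pgen (block_pred A)^' G.
  apply: (pi_projector_sub_normal permP.1 nsDG (normal_refl G)) => //.
    exact: normal_sub.
  by rewrite -(pnatNK (block_pred A)) pgen_index.
pose V := <<class_support K G>>%G.
have nsVG: V <| G.
  rewrite /normal gen_subG class_support_subG ?(subset_trans (pgen_sub _ _)) //.
  by rewrite norms_gen // class_support_norm.
exists V; split=> //; first by rewrite sub_gen // sub_class_support.
apply: gcore_max; last exact: normal_norm (normal_pgen _ nsVG).
apply: subset_trans (absH A P sA permP); apply: pgenS => //.
rewrite gen_subG class_supportEr; apply/bigcupsP=> x /(subsetP defG).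
rewrite normC => [/mulsgP[d y Dd Py ->]|]; last first.
  exact: subset_trans (perm_projector_sub permP) (normal_norm nsDG).
rewrite conjsgM (normsP nK) // -(conjGid (_ : y \in H <*> P)).
  by rewrite conjSg (subset_trans (pgen_sub _ _)) ?joing_subl.
exact: (subsetP (joing_subr _ _)).
Qed.

Lemma absorbing_index A H Q :
    perm_projector A H Q -> Q \subset 'N(H) ->
  pgen (block_pred A)^' (H <*> Q) \subset H.
Proof.
move=> permQ nHQ; apply: pgen_index_sub.
  by rewrite /normal joing_subl join_subG normG.
rewrite pnatNK /= comm_joingE ?indexMg.
  exact: pnat_dvd (dvdn_indexg _ _) (perm_projector_group permQ).
exact: perm_projector_commute permQ.
Qed.

(** Induction on the index of H: a conjugate of H under Q, other than H, is
    joined to H to give H1 <= HQ.  For a p-element u of HQ, where p lies in a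
    block B other than A, the induction hypothesis puts
    u into H1 and, modulo the core M of H1, into a normal B-subgroup of G; thus
    u lies in P M for a B-projector P.  In Z = H1 :&: P M the subgroup
    T = (H1 :&: P) F, with F = O^A(M), has A-index, so u is conjugate in Z to an
    element of T; and all Z-conjugates of T lie in H. *)
Theorem permutable_absorbing H :
  H \subset G -> sigma_p_permutable sigma G H -> absorbing H.
Proof.
have [n] := ubnP (#|G| - #|H|); elim: n => // n IHn in H *.
rewrite ltnS => leGHn sHG permH A Q sA permQ.
have [nHQ | /subsetPn[q Qq nHq]] := boolP (Q \subset 'N(H)).
  exact: absorbing_index.
have Gq := subsetP (perm_projector_sub permQ) q Qq.
pose H1 := (H <*> H :^ q)%G.
have sHH1: H \subset H1 by apply: joing_subl.
have sH1G: H1 \subset G by rewrite join_subG sHG -(conjGid Gq) conjSg.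
have sH1HQ: H1 \subset H <*> Q.
  rewrite join_subG joing_subl.
  rewrite -(conjGid (subsetP (joing_subr H Q) q Qq)) conjSg.
  exact: joing_subl.
(* H :^ q permutes with P :^ x because H permutes with P :^ (x * q^-1). *)
have permH1P B P : perm_projector B H P -> perm_projector B H1 P.
  case=> projP cHP; split=> // x Gx; apply: commute_joing; first exact: cHP.
  have eqHP: H * P :^ (x * q^-1) = P :^ (x * q^-1) * H.
    by apply: cHP; rewrite groupM ?groupV.
  have eqPx: P :^ x = (P :^ (x * q^-1)) :^ q by rewrite -conjsgM mulgKV.
  by rewrite /commute /= eqPx -!conjsMg eqHP.
have /sigma_p_permutableP permH' := permH.
have permH1 : sigma_p_permutable sigma G H1.
  apply/sigma_p_permutableP=> B sB; have [P permP] := permH' B sB.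
  by exists P; apply: permH1P.
have absH1: absorbing H1.
  apply: IHn => //; apply: leq_trans leGHn; apply: ltn_sub2l.
    apply: leq_trans (subset_leq_card sH1G); apply: proper_card.
    rewrite properE sHH1; apply: contra nHq => sH1H.
    by rewrite inE (subset_trans (joing_subr _ _) sH1H).
  apply: proper_card; rewrite properE sHH1; apply: contra nHq => sH1H.
  by rewrite inE (subset_trans (joing_subr _ _) sH1H).
pose M := gcore_group H1 G.
have nsMG: M <| G := gcore_normal sH1G.
have sMH1: M \subset H1 := gcore_sub H1 G.
pose F := pgen_group (block_pred A)^' M.
have sFH: F \subset H.
  exact: (normal_sub_perm_join sHG permH sA permQ nsMG (subset_trans sMH1 _)).
have nsFG: F <| G := normal_pgen _ nsMG.
have sQG := perm_projector_sub permQ.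
apply: pgen_compl_sub; first by rewrite join_subG sHG.
move=> B sB neBA; apply: pgen_prime_sub => p u pB HQu p_u.
have B_u: (block_pred B).-elt u by apply: pi_pnat p_u _.
have H1u: u \in H1.
  apply: (subsetP (absH1 A Q sA (permH1P _ _ permQ))); apply: mem_pgen.
    apply: (subsetP _ u HQu); rewrite join_subG joing_subr andbT.
    exact: subset_trans sHH1 (joing_subl _ _).
  by apply: sub_p_elt B_u => r; apply: block_disjoint.
have [V [nsVG sH1V sVM]] := absorbing_normal_closure sH1G permH1 absH1 sB.
have [P permP] := permH' B sB.
have sVPM: V \subset P * M.
  apply: subset_trans (joing_subl V M) _.
  have nsVM : V <*> M <| G by rewrite normalY.
  apply: (pi_projector_sub_normal permP.1 nsMG nsVM); rewrite ?joing_subr //.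
  have nMV := subset_trans (normal_sub nsVG) (normal_norm nsMG).
  rewrite /= norm_joinEl // normC // indexMg.
  by rewrite (pnat_dvd (indexgS _ sVM)) // -(pnatNK (block_pred B)) pgen_index.
have PMu: u \in P * M.
  by apply: (subsetP sVPM); apply: (subsetP sH1V); apply: mem_pgen.
have sPG := perm_projector_sub permP.
pose Z := (H1 :&: P <*> M)%G.
have defZ: Z :=: (H1 :&: P) * M.
  by rewrite group_modr // -norm_joinEl // (subset_trans sPG) ?normal_norm.
pose T := ((H1 :&: P) <*> F)%G.
have sTZ: T \subset Z.
  rewrite join_subG subsetI subsetIl.
  rewrite (subset_trans (subsetIr _ _)) ?joing_subl //.
  rewrite subsetI (subset_trans sFH) //.
  by rewrite (subset_trans (pgen_sub _ _)) ?joing_subr.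
have A_ZT: (block_pred A).-nat #|Z : T|.
  have -> : Z :=: T * M.
    apply/eqP; rewrite eqEsubset {1}defZ mulSg ?joing_subl //.
    by rewrite mul_subG // defZ mulG_subr.
  rewrite indexMg; apply: (@pnat_dvd _ #|M : F|).
    by rewrite indexgS ?joing_subr.
  by rewrite -(pnatNK (block_pred A)) pgen_index.
(* Since p is not in A, Sylow p-subgroups of T are Sylow in Z. *)
have [S sylS] := Sylow_exists p T; have [sST pS p'TS] := and3P sylS.
have sylSZ: p.-Sylow(Z) S.
  rewrite /pHall (subset_trans sST) // pS -(Lagrange_index sTZ sST) pnatM.
  rewrite p'TS andbT; apply: sub_in_pnat A_ZT => r _ Ar.
  by rewrite !inE; apply: contraTneq Ar => ->; apply: (block_disjoint sA sB).
have Zu: u \in Z.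
  rewrite inE H1u; apply: (subsetP _ u PMu).
  by rewrite mul_subG ?joing_subl ?joing_subr.
have [|z Zz] := Sylow_subJ sylSZ (_ : <[u]> \subset Z) p_u.
  by rewrite cycle_subG.
rewrite cycle_subG => /(subsetP _ u); apply.
have [H1z _] := setIP Zz; have Gz := subsetP sH1G z H1z.
apply: subset_trans (_ : T :^ z \subset H); first by rewrite conjSg.
rewrite conjYg join_subG (normsP (normal_norm nsFG)) // sFH andbT.
rewrite conjIg (conjGid H1z).
have permPz := perm_projectorJ Gz permP.
apply: subset_trans (perm_projector_capI sA sB neBA permQ permPz).
by rewrite setIC setISS // joing_subr.
Qed.

End OnePartition.

End Permutability.

(** * Properties for the meet of two partitions *)

Section Meets.

Variables (gT : finGroupType) (G : {group gT}).
Variables sigma1 sigma2 : {fset {fset nat}}.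

Lemma sigma_nilpotent_meet :
    sigma_nilpotent sigma1 G -> sigma_nilpotent sigma2 G ->
  sigma_nilpotent (partition_meet sigma1 sigma2) G.
Proof.
move=> nil1 nil2 _ /partition_meet_blocks[A [B [sA sB ->]]].
have [K [nsKG /and3P[sKG piK iK]]] := nil1 A sA.
have [L [nsLG /and3P[sLG piL iL]]] := nil2 B sB.
exists (K :&: L)%G; split; first exact: normalI.
rewrite /pHall subIset ?sKG //= /pgroup block_pred_meet.
rewrite (pnat_dvd (cardSg (subsetIl K L)) piK).
rewrite (pnat_dvd (cardSg (subsetIr K L)) piL) /=.
rewrite -(Lagrange_index sKG (subsetIl K L)) indexgI pnatM; apply/andP; split.
  apply: sub_in_pnat iK => p _; apply: contra.
  by rewrite !inE => /andP[].
have iKL: #|K : L| %| #|G : L|.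
  by rewrite index_norm_dvd // (subset_trans sKG) ?normal_norm.
apply: sub_in_pnat (pnat_dvd iKL iL) => p _; apply: contra.
by rewrite !inE => /andP[].
Qed.

Lemma sigma_soluble_meet :
    sigma_soluble sigma1 G -> sigma_soluble sigma2 G ->
  sigma_soluble (partition_meet sigma1 sigma2) G.
Proof.
move=> sol1 sol2 U V chiefUV.
have [A sA piA] := sol1 U V chiefUV; have [B sB piB] := sol2 U V chiefUV.
apply: partition_meet_pnat sA sB _ piA piB.
have /andP[/maxgroupp/andP[/andP[_ not_sUV] nVG] nsUG] := chiefUV.
rewrite card_quotient ?(subset_trans (normal_sub nsUG)) //.
by rewrite indexg_gt1.
Qed.

Hypotheses (part1 : fset_partition sigma1 (prime_divisors #|G|))
           (part2 : fset_partition sigma2 (prime_divisors #|G|)).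

(** In fact H permutes with every (A `&` B)-projector of G. *)
Lemma sigma_p_permutable_meet (H : {group gT}) :
    H \subset G ->
    sigma_p_permutable sigma1 G H -> sigma_p_permutable sigma2 G H ->
  sigma_p_permutable (partition_meet sigma1 sigma2) G H.
Proof.
move=> sHG perm1 perm2 C /partition_meet_blocks[A [B [sA sB defC]]].
have abs1 := permutable_absorbing part1 sHG perm1.
have abs2 := permutable_absorbing part2 sHG perm2.
suff commHR R : pi_projector (block_pred C) G R -> commute H R.
  have [R projR] := pi_projector_exists (block_pred C) G.
  by exists R => // x Gx; apply: commHR; apply: pi_projectorJ.
move=> projR; have /pi_projectorP[sRG piR _] := projR.
pose c := gcore_group H G; have nscG : c <| G := gcore_normal sHG.
have sCA p : p \in block_pred C -> p \in block_pred A.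
  by rewrite defC !inE => /andP[].
have sCB p : p \in block_pred C -> p \in block_pred B.
  by rewrite defC !inE => /andP[].
have nAR : R \subset 'N(pgen (block_pred A)^' H).
  apply: subset_trans _ (pgen_projector_norm perm1 abs1 sA).
  apply/subsetP=> x Rx; apply: mem_pgen; first exact: (subsetP sRG).
  exact: sub_p_elt sCA (mem_p_elt piR Rx).
have nBR : R \subset 'N(pgen (block_pred B)^' H).
  apply: subset_trans _ (pgen_projector_norm perm2 abs2 sB).
  apply/subsetP=> x Rx; apply: mem_pgen; first exact: (subsetP sRG).
  exact: sub_p_elt sCB (mem_p_elt piR Rx).
pose W := (pgen (block_pred A)^' H <*> pgen (block_pred B)^' H <*> c)%G.
have nWR : R \subset 'N(W).
  by rewrite !normsY // (subset_trans sRG) ?normal_norm.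
have sWH : W \subset H by rewrite !join_subG !pgen_sub gcore_sub.
have sC'W : pgen (block_pred C)^' H \subset W.
  apply: pgen_prime_sub => p x; rewrite defC !inE negb_and => C'p Hx p_x.
  apply: (subsetP (joing_subl _ c)); case/orP: C'p => [A'p | B'p].
    apply: (subsetP (joing_subl _ _)); apply: mem_pgen => //.
    by apply: pi_pnat p_x _.
  apply: (subsetP (joing_subr _ _)); apply: mem_pgen => //.
  by apply: pi_pnat p_x _.
have [V1 [nsV1 sHV1 sV1c]] := absorbing_normal_closure part1 sHG perm1 abs1 sA.
have [V2 [nsV2 sHV2 sV2c]] := absorbing_normal_closure part2 sHG perm2 abs2 sB.
(* U c / c is both an A-group and a B-group, so the maximal C-subgroup R c / c
   of G / c contains it. *)
pose U := (V1 :&: V2)%G; have nsUG : U <| G by apply: normalI.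
have sURc : U \subset R * c.
  apply: subset_trans (joing_subl U c) _.
  apply: (pi_projector_sub_normal projR nscG); rewrite ?normalY ?joing_subr //.
  have ncU := subset_trans (normal_sub nsUG) (normal_norm nscG).
  rewrite /= (norm_joinEl ncU) (normC ncU) indexMg defC block_pred_meet.
  have iU (pi : nat_pred) : pgen pi^' U \subset c -> pi.-nat #|U : c|.
    by move/indexgS/pnat_dvd; apply; rewrite -(pnatNK pi) pgen_index.
  rewrite !iU //.
    by apply: subset_trans sV2c; rewrite pgenS ?subsetIr.
  by apply: subset_trans sV1c; rewrite pgenS ?subsetIl.
have sCHU : pgen (block_pred C) H \subset U.
  by rewrite subsetI (subset_trans _ sHV1) ?(subset_trans _ sHV2) // pgenS.
have sHWR : H \subset W * R.
  rewrite -normC // -norm_joinEl //.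
  apply/subsetP=> x Hx; rewrite -(consttC (block_pred C) x) groupM //.
    have: x.`_(block_pred C) \in R * c.
      apply: (subsetP sURc); apply: (subsetP sCHU).
      by apply: mem_pgen; [apply: groupX | apply: p_elt_constt].
    apply: subsetP; rewrite mul_subG ?joing_subl //.
    exact: subset_trans (joing_subr _ c) (joing_subr R W).
  apply: (subsetP (joing_subr R W)); apply: (subsetP sC'W).
  by apply: mem_pgen; [apply: groupX | apply: p_elt_constt].
have eqWR : H * R = W * R.
  apply/eqP; rewrite eqEsubset (mulSg R sWH) andbT.
  by apply: subset_trans (mulSg R sHWR) _; rewrite -mulgA mulGid.
rewrite /commute eqWR -normC //; apply/eqP; rewrite eqEsubset (mulgS R sWH) /=.
by rewrite (subset_trans (mulgS R sHWR)) // -(normC nWR) mulgA mulGid.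
Qed.

End Meets.

Theorem theorem1 :
  [/\ sigma_property (fun gT sigma G _ => @sigma_nilpotent gT sigma G),
      sigma_property (fun gT sigma G _ => @sigma_soluble gT sigma G),
      sigma_property (fun gT sigma G H => @sigma_subnormal gT sigma G H)
    & sigma_property (fun gT sigma G H => @sigma_p_permutable gT sigma G H)].
Proof.
split=> gT G H sHG; split.
- by move=> sigma1 sigma2 _ _; apply: sigma_nilpotent_meet.
- move=> sigma partG /(single_block_group partG)[A -> piG] B /fset1P->.
  by exists G; rewrite normal_refl /pHall subxx piG indexgg.
- by move=> sigma1 sigma2 _ _; apply: sigma_soluble_meet.
- move=> sigma partG /(single_block_group partG)[A -> piG] U V.
  case/andP=> _ /normal_sub sUG; exists A; first exact: fset11.
  exact: quotient_pgroup (pgroupS sUG piG).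
- by move=> sigma1 sigma2 _ _; apply: sigma_subnormal_meet.
- move=> sigma partG /(single_block_group partG)[A -> piG].
  apply/sigma_subnormal1/(@sigma_step_core _ _ _ _ 1 A) => //.
  + exact: fset11.
  + exact: sub1G.
  + exact: normal1.
  by rewrite indexg1.
- by move=> sigma1 sigma2 part1 part2; apply: sigma_p_permutable_meet.
move=> sigma partG /(single_block_group partG)[A -> piG] B /fset1P->.
exists G => [|x Gx]; last by rewrite conjGid // (mulGSid sHG) (mulSGid sHG).
apply/pi_projectorP; split=> // N T _ _ _ sTG _.
exact: subset_trans sTG (mulG_subl _ _).
Qed.
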